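(* Let $G=(V,E)$ be an $n$-node directed graph, and suppose it is promised that all demand pairs satisfy $P\subseteq S\times V$ for some set $S\subseteq V$. There is a deterministic polynomial-time online algorithm, which needs no knowledge of $P$, of $S$, or of $p=|P|$, that constructs a reachability preserver $H$ of the $p$ demand pairs with $$|E(H)|\le O\left((n|S|p)^{1/2}+n\right).$$ The same bound holds under the promise $P\subseteq V\times S$ (using a slightly different algorithm, again deterministic, polynomial-time and needing no knowledge of $P$, $S$ or $p$).
   Context: Online reachability preserver model: an $n$-node directed graph $G=(V,E)$ is given as input, and $H\subseteq G$ starts with no edges. Demand pairs $(s,t)$ arrive one at a time; upon the arrival of $(s,t)$, and before the next pair arrives, the algorithm must irrevocably add edges of $G$ to $H$ so that $t$ is reachable from $s$ in $H$ whenever it is reachable in $G$. The process may stop at any time; $P$ is the set of demand pairs that arrive and $p=|P|$. *)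

(* Defs.v *)
(* MathComp; Stdlib R is used only for the size bound. *)
From Stdlib Require Import Reals.
From mathcomp Require Import all_boot.

Set Implicit Arguments.
Unset Strict Implicit.
Unset Printing Implicit Defensive.

(* MathComp takes the key R for its ring_scope. *)
Delimit Scope R_scope with coqR.

(** * Model of computation

    Deterministic while-programs with scalar registers and arrays over [nat],
    i.e. a structured random-access machine with the uniform cost measure.
    Multiplication is deliberately not primitive: with addition, truncated
    subtraction and comparisons only, the bit length of every stored number is
    at most linear in the running time (plus input length), so uniform
    polynomial time coincides with polynomial time on Turing machines. *)

Inductive expr : Type :=
  | Const of nat
  | Var of nat
  | Get of nat & expr            (* [Get a e]: entry [e] of array [a] *)
  | Add of expr & expr
  | Sub of expr & expr
  | Leq of expr & expr
  | Equ of expr & expr.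

Inductive cmd : Type :=
  | Skip
  | Assign of nat & expr
  | Put of nat & expr & expr     (* [Put a e1 e2]: entry [e1] of [a] := [e2] *)
  | Emit of expr & expr          (* irrevocably add the edge [(e1, e2)] to H *)
  | Seq of cmd & cmd
  | If of expr & cmd & cmd
  | While of expr & cmd.

(* [emitted] is write-only: no expression can read it. *)
Record state : Type := State {
  vars : nat -> nat;
  arrays : nat -> nat -> nat;
  emitted : seq (nat * nat)
}.

Definition upd (T : Type) (f : nat -> T) (x : nat) (v : T) : nat -> T :=
  fun y => if y == x then v else f y.

Definition set_var (x v : nat) (st : state) : state :=
  State (upd (vars st) x v) (arrays st) (emitted st).

Definition set_array (a i v : nat) (st : state) : state :=
  State (vars st) (upd (arrays st) a (upd (arrays st a) i v)) (emitted st).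

Definition emit (x y : nat) (st : state) : state :=
  State (vars st) (arrays st) ((x, y) :: emitted st).

Fixpoint eval (st : state) (e : expr) : nat :=
  match e with
  | Const k => k
  | Var x => vars st x
  | Get a e1 => arrays st a (eval st e1)
  | Add e1 e2 => eval st e1 + eval st e2
  | Sub e1 e2 => eval st e1 - eval st e2
  | Leq e1 e2 => eval st e1 <= eval st e2
  | Equ e1 e2 => eval st e1 == eval st e2
  end.

Fixpoint cost (e : expr) : nat :=
  match e with
  | Const _ | Var _ => 1
  | Get _ e1 => (cost e1).+1
  | Add e1 e2 | Sub e1 e2 | Leq e1 e2 | Equ e1 e2 => (cost e1 + cost e2).+1
  end.

(* [exec c st k st']: started in [st], the command [c] halts after [k] time
   units in state [st']. *)
Inductive exec : cmd -> state -> nat -> state -> Prop :=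
  | ExecSkip st :
      exec Skip st 1 st
  | ExecAssign x e st :
      exec (Assign x e) st (cost e).+1 (set_var x (eval st e) st)
  | ExecPut a e1 e2 st :
      exec (Put a e1 e2) st (cost e1 + cost e2).+1
        (set_array a (eval st e1) (eval st e2) st)
  | ExecEmit e1 e2 st :
      exec (Emit e1 e2) st (cost e1 + cost e2).+1
        (emit (eval st e1) (eval st e2) st)
  | ExecSeq c1 c2 st k1 st1 k2 st2 :
      exec c1 st k1 st1 -> exec c2 st1 k2 st2 ->
      exec (Seq c1 c2) st (k1 + k2) st2
  | ExecIf e c1 c2 st k st1 :
      exec (if eval st e != 0 then c1 else c2) st k st1 ->
      exec (If e c1 c2) st (cost e + k).+1 st1
  | ExecWhileStop e c st :
      eval st e = 0 ->
      exec (While e c) st (cost e).+1 st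
  | ExecWhileStep e c st k1 st1 k2 st2 :
      eval st e <> 0 ->
      exec c st k1 st1 -> exec (While e c) st1 k2 st2 ->
      exec (While e c) st (cost e + k1 + k2).+1 st2.

(** * Online reachability preservers

    An online algorithm is a single command, run once per arrival, whose
    registers and arrays persist between arrivals.  Graphs have vertex set
    ['I_n] and edge relation [E]; on start-up register 0 holds [n], array 0 the
    adjacency matrix of [E] in row-major order, everything else is 0 and no edge
    has been emitted.  A demand [(s, t)] is delivered in registers 1 and 2. *)

Definition adjacency (n : nat) (E : rel 'I_n) (i : nat) : nat :=
  [exists u : 'I_n, exists v : 'I_n, (i == u * n + v) && E u v].

Definition start (n : nat) (E : rel 'I_n) : state :=
  State (upd (fun=> 0) 0 n) (upd (fun=> fun=> 0) 0 (adjacency E)) [::].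

Definition arrive (n : nat) (d : 'I_n * 'I_n) (st : state) : state :=
  set_var 2 d.2 (set_var 1 d.1 st).

Inductive serve (A : cmd) (n : nat) :
    state -> seq ('I_n * 'I_n) -> nat -> state -> Prop :=
  | ServeNil st :
      serve A st [::] 0 st
  | ServeCons d ds st k1 st1 k2 st2 :
      exec A (arrive d st) k1 st1 -> serve A st1 ds k2 st2 ->
      serve A st (d :: ds) (k1 + k2) st2.

(* The edge set of H; pairs with an entry outside ['I_n] are excluded by
   [sound_output] below. *)
Definition edges (n : nat) (st : state) : {set 'I_n * 'I_n} :=
  [set d : 'I_n * 'I_n | (val d.1, val d.2) \in emitted st].

Definition sound_output (n : nat) (E : rel 'I_n) (st : state) : Prop :=
  forall x y : nat, (x, y) \in emitted st ->
    exists u v : 'I_n, [/\ x = u, y = v & E u v].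

Definition reachability_preserver (n : nat) (E : rel 'I_n)
    (P H : {set 'I_n * 'I_n}) : Prop :=
  forall s t : 'I_n, (s, t) \in P ->
    connect E s t -> connect [rel u v | (u, v) \in H] s t.

Definition demands (n : nat) (ds : seq ('I_n * 'I_n)) : {set 'I_n * 'I_n} :=
  [set d in ds].

(* Every prefix of a run is itself a run ([serve_cat]), runs are unique
   ([serve_det]) and emitted edges are never withdrawn ([serve_irrevocable]).
   Hence quantifying over all finite arrival sequences [ds] says that H is a
   preserver of the pairs seen so far after each arrival, before the next one.
   Arrival sequences may repeat a pair. *)
Definition online_preserver_algorithm (A : cmd) : Prop :=
  forall (n : nat) (E : rel 'I_n) (ds : seq ('I_n * 'I_n)),
    exists (k : nat) (st : state),
      [/\ serve A (start E) ds k st,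
          sound_output E st
        & reachability_preserver E (demands ds) (edges n st)].

Definition polynomial_time (A : cmd) : Prop :=
  exists c e : nat,
    forall (n : nat) (E : rel 'I_n) (ds : seq ('I_n * 'I_n)) (k : nat)
      (st : state),
      serve A (start E) ds k st -> k <= c * (n + size ds).+1 ^ e.

(** * Sanity of the model *)

Lemma exec_det c st k1 st1 k2 st2 :
  exec c st k1 st1 -> exec c st k2 st2 -> k1 = k2 /\ st1 = st2.
Proof.
move=> ex1; elim: ex1 k2 st2 => {c st k1 st1}.
- by move=> st k2 st2 ex2; inversion ex2.
- by move=> x e st k2 st2 ex2; inversion ex2.
- by move=> a e1 e2 st k2 st2 ex2; inversion ex2.
- by move=> e1 e2 st k2 st2 ex2; inversion ex2.
- move=> c1 c2 st k1 st1 k1' st1' _ IH1 _ IH2 k2 st2 ex2.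
  inversion ex2 as [| | | |? ? ? ? ? ? ? exl exr| | |]; subst.
  have [e1 e2] := IH1 _ _ exl; subst.
  by have [-> ->] := IH2 _ _ exr.
- move=> e c1 c2 st k st1 _ IH k2 st2 ex2.
  inversion ex2 as [| | | | |? ? ? ? ? ? ex| |]; subst.
  by have [-> ->] := IH _ _ ex.
- by move=> e c st e0 k2 st2 ex2; inversion ex2; subst.
- move=> e c st k1 st1 k1' st1' ne0 _ IH1 _ IH2 k2 st2 ex2.
  inversion ex2 as [| | | | | | |? ? ? ? ? ? ? _ exl exr]; subst=> //.
  have [e1 e2] := IH1 _ _ exl; subst.
  by have [-> ->] := IH2 _ _ exr.
Qed.

Lemma serve_det A n st (ds : seq ('I_n * 'I_n)) k1 st1 k2 st2 :
  serve A st ds k1 st1 -> serve A st ds k2 st2 -> k1 = k2 /\ st1 = st2.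
Proof.
move=> sv1; elim: sv1 k2 st2 => {st ds k1 st1}.
  by move=> st k2 st2 sv2; inversion sv2.
move=> d ds st k1 st1 k1' st1' ex1 _ IH k2 st2 sv2.
inversion sv2 as [|? ? ? ? ? ? ? ex sv]; subst.
have [e1 e2] := exec_det ex1 ex; subst.
by have [-> ->] := IH _ _ sv.
Qed.

Lemma serve_cat A n st (ds1 ds2 : seq ('I_n * 'I_n)) k st2 :
  serve A st (ds1 ++ ds2) k st2 ->
  exists k1 k2 st1,
    [/\ serve A st ds1 k1 st1, serve A st1 ds2 k2 st2 & k = k1 + k2].
Proof.
elim: ds1 st k => [|d ds1 IH] st k sv /=.
  by exists 0, k, st; split=> //; apply: ServeNil.
inversion sv as [|? ? ? k1 ? ? ? ex sv']; subst.
have [k1' [k2' [st1' [sv1 sv2 ->]]]] := IH _ _ sv'.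
exists (k1 + k1'), k2', st1'; split=> //; last by rewrite addnA.
exact: ServeCons ex sv1.
Qed.

Lemma exec_irrevocable c st k st' :
  exec c st k st' -> {subset emitted st <= emitted st'}.
Proof.
elim=> {c st k st'} //.
- by move=> st d.
- by move=> x e st d.
- by move=> a e1 e2 st d.
- by move=> e1 e2 st d d_st; rewrite inE d_st orbT.
- by move=> c1 c2 st k1 st1 k2 st2 _ s1 _ s2 d /s1/s2.
- by move=> e c st _ d.
- by move=> e c st k1 st1 k2 st2 _ _ s1 _ s2 d /s1/s2.
Qed.

Lemma serve_irrevocable A n st (ds : seq ('I_n * 'I_n)) k st' :
  serve A st ds k st' -> {subset emitted st <= emitted st'}.
Proof.
elim=> {st ds k st'} [st x //|d ds st k1 st1 k2 st2 /exec_irrevocable s1 _ s2].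
by move=> x x_st; apply/s2/s1.
Qed.

(* Main.v *)
(* Serve a demand (s, t) by walking backwards from t: at a vertex x that is not
   strongly connected to s, follow an edge (u, v) such that v lies in the component
   of x, u does not, and s reaches u, and prefer an edge that is already in H. Inside
   a component H has been given an in-tree and an out-tree once and for all, which
   costs at most 2n edges. When a new edge with source s is added into a component,
   s reaches the tail of no earlier edge entering it. Hence, if two of the edges
   added for one demand d both had later edges with a common source s entering
   the same components, then s would reach the head of one, thus the tail of the
   other, which is impossible. So the pairs of added edges entering a common
   component inject into P x S, and by Cauchy-Schwarz m added edges satisfy
   m^2 <= n (2 |P| |S| + m).
   For demands in V x S the same walk is run on the reverse graph. *)

Require Import Defs.
From Stdlib Require Import Reals Lra.
From mathcomp Require Import all_boot.
From mathcomp Require Import zify.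

Set Implicit Arguments.
Unset Strict Implicit.
Unset Printing Implicit Defensive.

(** * Programs with loops bounded by the number of vertices *)

(* [For x p] runs [p] with register [x] set to 0, ..., n-1, where n is the
   content of register 0. *)
Inductive prog : Type :=
  | Let of nat & expr
  | Store of nat & expr & expr
  | Out of expr & expr
  | Then of prog & prog
  | Test of expr & prog
  | For of nat & prog.

Definition more (x : nat) : expr := Leq (Add (Var x) (Const 1)) (Var 0).
Definition next (x : nat) : cmd := Assign x (Add (Var x) (Const 1)).

Fixpoint compile (p : prog) : cmd :=
  match p with
  | Let x e => Assign x e
  | Store a e1 e2 => Put a e1 e2
  | Out e1 e2 => Emit e1 e2
  | Then p q => Seq (compile p) (compile q)
  | Test e p => If e (compile p) Skip
  | For x p => Seq (Assign x (Const 0)) (While (more x) (Seq (compile p) (next x)))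
  end.

(** A total counterpart of [exec]. The [For] case reads its bound once, on entry, whereas the
    compiled loop rereads register 0 in every round; [well_formed] makes the two agree. *)
Fixpoint run (p : prog) (st : state) : state :=
  match p with
  | Let x e => set_var x (eval st e) st
  | Store a e1 e2 => set_array a (eval st e1) (eval st e2) st
  | Out e1 e2 => emit (eval st e1) (eval st e2) st
  | Then p q => run q (run p st)
  | Test e p => if eval st e != 0 then run p st else st
  | For x p =>
      iter (vars st 0) (fun st' => let st1 := run p st' in
                                   set_var x (vars st1 x + 1) st1)
           (set_var x 0 st)
  end.

Fixpoint assigned (p : prog) : seq nat :=
  match p with
  | Let x _ => [:: x]
  | Then p q => assigned p ++ assigned q
  | Test _ p => assigned p
  | For x p => x :: assigned p
  | _ => [::]
  end.

Fixpoint stored (p : prog) : seq nat :=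
  match p with
  | Store a _ _ => [:: a]
  | Then p q => stored p ++ stored q
  | Test _ p | For _ p => stored p
  | _ => [::]
  end.

Fixpoint silent (p : prog) : bool :=
  match p with
  | Out _ _ => false
  | Then p q => silent p && silent q
  | Test _ p | For _ p => silent p
  | _ => true
  end.

Fixpoint well_formed (p : prog) : bool :=
  match p with
  | Let x _ => x != 0
  | Then p q => well_formed p && well_formed q
  | Test _ p => well_formed p
  | For x p => [&& x != 0, x \notin assigned p & well_formed p]
  | _ => true
  end.

Definition frame (p : prog) (st st' : state) : Prop :=
  [/\ forall y, y \notin assigned p -> vars st' y = vars st y,
      forall a, a \notin stored p -> arrays st' a = arrays st a
    & silent p -> emitted st' = emitted st].

Lemma frame_run p st : frame p st (run p st).
Proof.
elim: p st => [x e|a e1 e2|e1 e2|p IHp q IHq|e p IHp|x p IHp] st //=.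
- by split=> // y; rewrite inE /= /upd => /negPf->.
- by split=> // y; rewrite inE /= /upd => /negPf->.
- have [v1 a1 o1] := IHp st; have [v2 a2 o2] := IHq (run p st).
  split=> [y|a|]; rewrite /= ?mem_cat ?negb_or => /andP[h1 h2].
  + by rewrite v2 // v1.
  + by rewrite a2 // a1.
  + by rewrite o2 // o1.
- by case: ifP => _; [apply: IHp|split].
- elim: (vars st 0) => [|k [v1 a1 o1]] /=.
    by split=> //= y; rewrite inE negb_or /upd => /andP[/negPf->].
  set st1 := iter k _ _ in v1 a1 o1 *; have [v2 a2 o2] := IHp st1.
  split=> [y|a|] /= => [|h|h].
  + rewrite inE negb_or /upd => /andP[nyx h].
    by rewrite /upd (negPf nyx) v2 // v1 //= inE negb_or nyx.
  + by rewrite a2 // a1.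
  + by rewrite o2 // o1.
Qed.

Lemma well_formed_keeps0 p : well_formed p -> 0 \notin assigned p.
Proof.
elim: p => [x e|a e1 e2|e1 e2|p IHp q IHq|e p IHp|x p IHp] //=.
- by rewrite inE eq_sym.
- by rewrite mem_cat negb_or => /andP[/IHp-> /IHq->].
- by rewrite inE negb_or => /and3P[x0 _ /IHp->]; rewrite eq_sym x0.
Qed.

(** In the [For] case a round pays 5 for the guard, 4 for the increment and 1 for the loop itself;
    the final 8 pays for the initial assignment (2) and the failing guard (6). *)
Fixpoint budget (p : prog) (n : nat) : nat :=
  match p with
  | Let _ e => (cost e).+1
  | Store _ e1 e2 | Out e1 e2 => (cost e1 + cost e2).+1
  | Then p q => budget p n + budget q n
  | Test e p => (cost e + (budget p n + 1)).+1
  | For x p => n * (budget p n + 10) + 8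
  end.

Lemma exec_compile p st : well_formed p ->
  exists2 k, exec (compile p) st k (run p st) & k <= budget p (vars st 0).
Proof.
elim: p st => [x e|a e1 e2|e1 e2|p IHp q IHq|e p IHp|x p IHp] st /=.
- by move=> _; eexists; [constructor|].
- by move=> _; eexists; [constructor|].
- by move=> _; eexists; [constructor|].
- move=> /andP[wp wq].
  have [k1 ex1 le1] := IHp st wp; have [k2 ex2 le2] := IHq (run p st) wq.
  exists (k1 + k2); first exact: ExecSeq ex1 ex2.
  have [vp _ _] := frame_run p st.
  by rewrite leq_add // (leq_trans le2) // vp // well_formed_keeps0.
- move=> wp; have [k ex le] := IHp st wp.
  case e0: (eval st e != 0).
    exists (cost e + k).+1; first by apply: ExecIf; rewrite e0.
    by rewrite ltnS leq_add2l (leq_trans le) ?leq_addr.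
  exists (cost e + 1).+1; first by apply: ExecIf; rewrite e0; constructor.
  by rewrite ltnS leq_add2l leq_addl.
- move=> /and3P[x0 xp wp]; set n := vars st 0.
  set body := fun st' : state => _.
  (* Induction on the number [k] of rounds still to come. *)
  suff loop k st1 : vars st1 0 = n -> vars st1 x + k = n ->
      exists2 c, exec (While (more x) (Seq (compile p) (next x))) st1 c
                      (iter k body st1) & c <= k * (budget p n + 10) + 6.
    have [] := loop n (set_var x 0 st).
    + by rewrite /= /upd eq_sym (negPf x0).
    + by rewrite /= /upd eqxx.
    + move=> c ex le; exists (2 + c); first by apply: ExecSeq ex; constructor.
      by rewrite addnC (leq_trans (leq_add le (leqnn 2))) // -addnA.
  elim: k st1 => [|k IHk] st1 vn vx.
    exists 6 => //; apply: (ExecWhileStop (e := more x)).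
    by move: vx => /=; rewrite vn; lia.
  have [k1 ex1 le1] := IHp st1 wp.
  have [v1 _ _] := frame_run p st1.
  have [] := IHk (body st1).
  + by rewrite /body /= /upd eq_sym (negPf x0) v1 // well_formed_keeps0.
  + by rewrite /body /= /upd eqxx v1 //; lia.
  move=> c ex le; exists (5 + (k1 + 4) + c).+1.
    rewrite iterSr; apply: (ExecWhileStep (e := more x)) ex.
      by move: vx => /=; rewrite vn; lia.
    by apply: ExecSeq ex1 _; constructor.
  by rewrite mulSn; move: le1; rewrite vn; lia.
Qed.

Lemma budget_poly p : exists c e, forall n, budget p n <= c * n.+1 ^ e.
Proof.
elim: p => [x e|a e1 e2|e1 e2|p [c1 [a1 h1]] q [c2 [a2 h2]]
           |e p [c [a h]]|x p [c [a h]]] /=.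
- by exists (cost e).+1, 0 => n; rewrite muln1.
- by exists (cost e1 + cost e2).+1, 0 => n; rewrite muln1.
- by exists (cost e1 + cost e2).+1, 0 => n; rewrite muln1.
- exists (c1 + c2), (a1 + a2) => n; rewrite mulnDl leq_add //.
    by rewrite (leq_trans (h1 n)) // leq_mul2l leq_pexp2l ?leq_addr ?orbT.
  by rewrite (leq_trans (h2 n)) // leq_mul2l leq_pexp2l ?leq_addl ?orbT.
- exists (cost e + c + 2), a => n.
  have := h n; have : 0 < n.+1 ^ a by rewrite expn_gt0.
  by move: (n.+1 ^ a) => m; nia.
- exists (c + 18), a.+1 => n; rewrite expnS.
  have := h n; have : 0 < n.+1 ^ a by rewrite expn_gt0.
  by move: (n.+1 ^ a) => m m0 hm; nia.
Qed.

(* As each round may use the frame of the whole loop, [I] need only mention what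
   the body changes. *)
Lemma run_for n x p (I : nat -> state -> Prop) st :
    vars st 0 = n -> well_formed (For x p) ->
    I 0 (set_var x 0 st) ->
    (forall (i : 'I_n) st', vars st' x = i -> frame (For x p) st st' -> I i st' ->
      I i.+1 (set_var x i.+1 (run p st'))) ->
  I n (run (For x p) st).
Proof.
move=> vn /= /and3P[x0 xp wp] I0 step; rewrite vn.
set body := fun st' : state => _.
suff [] : [/\ I n (iter n body (set_var x 0 st)),
  vars (iter n body (set_var x 0 st)) x = n &
  frame (For x p) st (iter n body (set_var x 0 st))] by [].
elim: {-2}n (leqnn n) => [_|k IHk lt_kn].
  split=> //=; first by rewrite /upd eqxx.
  by split=> //= y; rewrite inE negb_or /upd => /andP[/negPf->].
have [Ik vk fk] := IHk (ltnW lt_kn).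
set st1 := iter k _ _ in Ik vk fk *; have fp := frame_run p st1.
rewrite iterS -/st1 /body /= /upd eqxx.
have vx : vars (run p st1) x = k by case: fp => -> //.
rewrite vx addn1; split=> //; first exact: (step (Ordinal lt_kn)).
case: fk fp => [v1 a1 o1] [v2 a2 o2]; split=> /= [y|a h|h].
- rewrite inE negb_or => /andP[nyx h].
  by rewrite /upd (negPf nyx) v2 // v1 //= inE negb_or nyx.
- by rewrite a2 // a1.
- by rewrite o2 // o1.
Qed.

(** * Counting the edges of a growth log *)

Section Log.
Variables (n : nat) (E : rel 'I_n).

Definition scc : rel 'I_n := [rel u v | connect E u v && connect E v u].

(** [pick] depends only on the extension of the predicate, so all vertices of a component get the
    same representative. *)
Definition class (v : 'I_n) : 'I_n := odflt v [pick w | scc v w].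

Lemma scc_trans : transitive scc.
Proof.
move=> y x z /andP[xy yx] /andP[yz zy].
by rewrite /scc /= (connect_trans xy yz) (connect_trans zy yx).
Qed.

Lemma scc_sym : symmetric scc.
Proof. by move=> x y; rewrite /scc /= andbC. Qed.

Lemma scc_refl : reflexive scc.
Proof. by move=> x; rewrite /scc /= connect0. Qed.

Lemma class_scc v : scc v (class v).
Proof. by rewrite /class; case: pickP => //= _; apply: scc_refl. Qed.

Lemma eq_class u v : (class u == class v) = scc u v.
Proof.
apply/eqP/idP => [uv|uv].
  apply: scc_trans (class_scc u) _.
  by rewrite uv scc_sym class_scc.
have sim : scc u =1 scc v.
  move=> w; apply/idP/idP; apply: scc_trans => //.
  by rewrite scc_sym.
rewrite /class (eq_pick sim); case: pickP => //= none.
by have := none v; rewrite scc_refl.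
Qed.

(* An entry [((s, t), (u, v))] records that the edge [(u, v)] was added while
   serving the demand [(s, t)]; the most recent entry comes first. *)
Definition entry : Type := (('I_n * 'I_n) * ('I_n * 'I_n))%type.

Definition sound_entry (a : entry) : bool :=
  let: ((s, _), (u, v)) := a in [&& E u v, connect E s u & ~~ connect E v u].

(** Here [a] is more recent than [b]. The first clause reflects the preference for old edges: an old
    edge into the same component with tail reachable from [s] would have been reused. The second
    reflects that a walk runs backwards, so its later edges lie upstream. *)
Definition follows (a b : entry) : bool :=
  let: (((s, _) as d), (_, v)) := a in let: (d', (u', v')) := b in
  (scc v v' ==> ~~ connect E s u') && ((d == d') ==> connect E v u').

Definition growth_log (L : seq entry) : bool :=
  all sound_entry L && pairwise follows L.

(** Cauchy-Schwarz against the constant 1, obtained by summing 2ab <= a^2 + b^2 over all pairs of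
    indices. *)
Lemma sum_sqr_bound (T : finType) (m : T -> nat) :
  (\sum_i m i) * (\sum_i m i) <= #|T| * \sum_i m i * m i.
Proof.
rewrite -(leq_pmul2l (isT : 0 < 2)) big_distrlr big_distrr /=.
pose f i j := m i * m i + m j * m j.
apply: (@leq_trans (\sum_i \sum_j f i j)).
  apply: leq_sum => i _; rewrite big_distrr; apply: leq_sum => j _ /=.
  by rewrite /f; have := nat_Cauchy (m i) (m j); rewrite -!mulnn => -[].
under eq_bigr do rewrite /f big_split sum_nat_const /=.
by rewrite big_split sum_nat_const -big_distrr /= mul2n addnn.
Qed.

Definition head_class (L : seq entry) (i : 'I_(size L)) : 'I_n :=
  class (tnth (in_tuple L) i).2.2.

(* If two of the edges added for one demand [d] had later edges with the same
   source [s] entering the same components, then [s] would reach the tail of one of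
   the two through the head of the other. So [(d, s)] determines the pair. *)
Lemma collisions_bound (L : seq entry) (S : {set 'I_n}) (D : {set 'I_n * 'I_n}) :
    growth_log L ->
    {in L, forall a, a.1 \in D /\ a.1.1 \in S} ->
  #|[set ij : 'I_(size L) * 'I_(size L) |
      (ij.1 < ij.2) && (head_class ij.1 == head_class ij.2)]| <= #|D| * #|S|.
Proof.
move=> /andP[/allP sound pw] inDS.
rewrite /head_class; set l := tnth (in_tuple L).
have lL i : l i \in L by apply: mem_tnth.
have fol (i j : 'I_(size L)) : i < j -> follows (l i) (l j).
  have [x0 _] : exists x0 : entry, True by exists (l i).
  by move=> ij; rewrite /l !(tnth_nth x0); apply: (pairwiseP x0 pw) => //; apply: ltn_ord.
(* A collision is sent to the demand of its older entry and the source of its newer one. *)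
pose g (ij : 'I_(size L) * 'I_(size L)) := ((l ij.2).1, (l ij.1).1.1).
set Q := [set _ | _].
(* The newer source reaches the common component, hence the older head, but by [follows] not the
   older tail. *)
have reach (i j : 'I_(size L)) : (i, j) \in Q ->
    connect E (l i).1.1 (l j).2.2 /\ ~~ connect E (l i).1.1 (l j).2.1.
  rewrite inE /= eq_class => /andP[/fol + vv].
  move: (sound _ (lL i)) vv.
  case: (l i) (l j) => [[s t] [u v]] [d' [u' v']] /= /and3P[uv su _] vv.
  rewrite vv => /andP[/= nsu _]; split=> //.
  by apply: connect_trans su (connect_trans (connect1 uv) _); case/andP: vv.
have inj : {in Q &, injective g}.
  move=> [i j] [i' j'] Qij Qij'; rewrite /g /= => - [ed es].
  have [vj uj] := reach _ _ Qij; have [vj' uj'] := reach _ _ Qij'.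
  have far (k k' : 'I_(size L)) : k < k' -> (l k).1 = (l k').1 ->
      connect E (l k).2.2 (l k').2.1.
    move=> /fol; case: (l k) (l k') => [[s t] [u v]] [d' [u' v']] /=.
    by move=> /andP[_ /implyP h] /eqP.
  (* Otherwise the common source reaches one of the two older heads, and by [far] through it the
     tail of the other. *)
  have ejj : j = j'.
    apply/val_inj/eqP; case: ltngtP => // lt; exfalso.
      by move/negP: uj'; apply; rewrite -es; apply: connect_trans vj (far _ _ _ _).
    by move/negP: uj; apply; rewrite es; apply: connect_trans vj' (far _ _ _ _).
  rewrite -{j'}ejj in Qij' vj' uj' ed *.
  (* Two entries with one source and heads in one component: [follows] forbids the source of the
     newer to reach the tail of the older, yet it is also the source of the older. *)
  have near (k k' : 'I_(size L)) : (k, j) \in Q -> (k', j) \in Q ->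
      (l k).1.1 = (l k').1.1 -> k < k' -> False.
    rewrite !inE /= => /andP[_ ekj] /andP[_ /eqP ekj'] es' lt.
    move: ekj; rewrite -ekj' eq_class => vv.
    have := fol _ _ lt; move: (sound _ (lL k')) vv es'.
    case: (l k) (l k') => [[s t] [u v]] [[s' t'] [u' v']] /= /and3P[_ su' _] vv ->.
    by rewrite vv su'.
  congr (_, _); apply/val_inj/eqP; case: ltngtP => // lt; exfalso.
    exact: near Qij Qij' es lt.
  by apply: near Qij' Qij _ lt.
rewrite -(card_in_imset inj) -cardsX; apply/subset_leq_card/subsetP => x.
case/imsetP => -[i j] _ ->; rewrite inE /g /=.
by have [-> _] := inDS _ (lL j); have [_ ->] := inDS _ (lL i).
Qed.

(** With m_w entries whose heads lie in component w, the m_w sum to [size L], and their squares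
    count the ordered pairs of entries with heads in a common component: twice the collisions, plus
    the diagonal. Cauchy-Schwarz over n vertices concludes. *)
Lemma growth_log_size (L : seq entry) (S : {set 'I_n}) (D : {set 'I_n * 'I_n}) :
    growth_log L ->
    {in L, forall a, a.1 \in D /\ a.1.1 \in S} ->
  size L * size L <= n * (2 * (#|D| * #|S|) + size L).
Proof.
move=> good inDS; have := collisions_bound good inDS.
set Q := [set _ | _] => leQ; set head := @head_class L in Q leQ.
pose m w := #|[set i | head i == w]|.
have sum_m : \sum_w m w = size L.
  rewrite -[RHS]card_ord -sum1_card (partition_big head predT) //=.
  by apply: eq_bigr => w _; rewrite sum1_card /m cardsE.
have sum_mm : \sum_w m w * m w =
    #|[set ij : 'I_(size L) * 'I_(size L) | head ij.1 == head ij.2]|.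
  rewrite -sum1_card (partition_big (fun ij => head ij.1) predT) //=.
  apply: eq_bigr => w _; rewrite sum1_card /m -cardsX; apply: eq_card => -[i j].
  rewrite !inE /= [in RHS]unfold_in /= inE /=.
  by apply/andP/andP=> -[/eqP h /eqP h']; rewrite ?h ?h' -?h' -?h.
pose Q' := [set (ij.2, ij.1) | ij in Q].
pose I := [set (i, i) | i : 'I_(size L)].
have : \sum_w m w * m w <= #|Q| + #|Q'| + #|I|.
  rewrite sum_mm; set T := [set _ | _].
  apply: (@leq_trans #|Q :|: Q' :|: I|); last first.
    have := leq_card_setU (Q :|: Q') I; have := leq_card_setU Q Q'.
    by case=> + _ [+ _]; lia.
  apply/subset_leq_card/subsetP => -[i j]; rewrite !inE /= => hij.
  case: (ltngtP i j) => [lt|lt|/val_inj eq] /=.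
  - by rewrite hij.
  - apply/orP; left; apply/imsetP; exists (j, i) => //.
    by rewrite inE /= lt eq_sym.
  - by apply/orP; right; apply/imsetP; exists i => //; rewrite eq.
have : #|Q'| <= #|Q| by apply: leq_imset_card.
have : #|I| <= size L.
  by rewrite (leq_trans (leq_imset_card _ _)) // cardE size_enum_ord.
have := sum_sqr_bound m; rewrite sum_m card_ord.
move: (\sum_w _) => M h1 h2 h3 h4.
by rewrite (leq_trans h1) // leq_mul2l; apply/orP; right; lia.
Qed.

End Log.

(** With x = sqrt(nq), m > n + 2x would give m(m - n) > 2xm >= 4x^2 >= 2nq. *)
Lemma sqrt_bound (n m q : nat) : m * m <= n * (2 * q + m) ->
  (INR m <= 2 * sqrt (INR (n * q)) + INR n)%coqR.
Proof.
move=> h.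
have {h} : (INR m * INR m <= INR n * (2 * INR q + INR m))%coqR.
  by rewrite -[2%coqR]/(INR 2) -!(mult_INR, plus_INR); apply/le_INR/leP.
have n0 := pos_INR n; have m0 := pos_INR m; have q0 := pos_INR q.
have nq0 : (0 <= INR n * INR q)%coqR by apply: Rmult_le_pos.
rewrite mult_INR; have := sqrt_sqrt _ nq0; have := sqrt_pos (INR n * INR q).
move: (sqrt _) => x x0 xx h; apply: Rnot_lt_le => lt.
have : (0 < (INR m - INR n - 2 * x) * INR m)%coqR.
  by apply: Rmult_lt_0_compat; lra.
have : (0 <= (INR m - INR n - 2 * x) * (2 * x))%coqR by apply: Rmult_le_pos; lra.
have : (0 <= INR n * x)%coqR by apply: Rmult_le_pos.
nra.
Qed.

Lemma frame_trans p st1 st2 st3 :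
  frame p st1 st2 -> frame p st2 st3 -> frame p st1 st3.
Proof.
move=> [v1 a1 o1] [v2 a2 o2]; split=> [y h|a h|h].
- by rewrite v2 // v1.
- by rewrite a2 // a1.
- by rewrite o2 // o1.
Qed.

Lemma frame_for x p st1 st2 : frame p st1 st2 -> frame (For x p) st1 st2.
Proof. by case=> v a o; split=> //= y; rewrite inE negb_or => /andP[_ /v]. Qed.

(** * Loops that only improve the state *)

Section GrowingLoops.
Variables (n : nat) (le : state -> state -> Prop).
Hypothesis le_trans : forall st1 st2 st3, le st1 st2 -> le st2 st3 -> le st1 st3.

(** Round i establishes [Q i], and later rounds preserve it because it is stable along [le]; this
    replaces an invariant indexed by the loop counter. *)
Lemma run_for_grow x p (Q : 'I_n -> state -> Prop) st :
    (forall k st', le st' (set_var x k st')) ->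
    (forall i st1 st2, le st1 st2 -> Q i st1 -> Q i st2) ->
    vars st 0 = n -> well_formed (For x p) ->
    (forall (i : 'I_n) st', vars st' x = i -> frame (For x p) st st' ->
      le st st' -> le st' (run p st') /\ Q i (run p st')) ->
  le st (run (For x p) st) /\ forall i, Q i (run (For x p) st).
Proof.
move=> le_set Q_le vn wf step.
suff [h1 h2] : le st (run (For x p) st) /\
    forall i : 'I_n, i < n -> Q i (run (For x p) st).
  by split=> // i; apply/h2/ltn_ord.
pose I k st' := le st st' /\ forall i : 'I_n, i < k -> Q i st'.
apply: (@run_for n x p I st) => //.
move=> i st' vx fr [le1 Q1]; have [le2 Q2] := step i st' vx fr le1.
have le3 := le_set i.+1 (run p st').
have le4 := le_trans le2 le3; split=> [|j].
  exact: le_trans le1 le4.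
rewrite ltnS leq_eqVlt => /predU1P[/val_inj->|/Q1]; first exact: Q_le Q2.
exact: Q_le.
Qed.

Lemma run_for2_grow x y p (Q : 'I_n -> 'I_n -> state -> Prop) st :
    (forall k st', le st' (set_var x k st')) ->
    (forall k st', le st' (set_var y k st')) ->
    (forall i j st1 st2, le st1 st2 -> Q i j st1 -> Q i j st2) ->
    vars st 0 = n -> well_formed (For x (For y p)) ->
    (forall (i j : 'I_n) st', vars st' x = i -> vars st' y = j ->
      frame (For x (For y p)) st st' ->
      le st st' -> le st' (run p st') /\ Q i j (run p st')) ->
  le st (run (For x (For y p)) st) /\
  forall i j, Q i j (run (For x (For y p)) st).
Proof.
move=> le_x le_y Q_le vn wf step.
apply: (run_for_grow (Q := fun i st' => forall j, Q i j st')) => //.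
  by move=> i st1 st2 le12 Q1 j; apply: Q_le (Q1 j).
have /and3P[x0 nx wfy] := wf.
move=> i st' vx fr le1; apply: run_for_grow => //.
- by move=> j; apply: Q_le.
- have [-> //] := fr; exact: well_formed_keeps0 wf.
- move=> j st2 vy fr2 le2.
  have vx2 : vars st2 x = i by have [-> //] := fr2.
  apply: step => //; last exact: le_trans le1 le2.
  exact: frame_trans fr (frame_for _ fr2).
Qed.

End GrowingLoops.

Lemma run_then p q st : run (Then p q) st = run q (run p st).
Proof. by []. Qed.

Definition tests (es : seq expr) (p : prog) : prog := foldr Test p es.

Lemma run_tests es p st :
  run (tests es p) st = if all (fun e => eval st e != 0) es then run p st else st.
Proof. by elim: es => //= e es ->; case: ifP. Qed.

Lemma bool_neq0 (b : bool) : ((b : nat) != 0) = b.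
Proof. by case: b. Qed.

(** * The algorithm *)

(* Registers: 3 tells whether the initialisation is done, 4 to 7 are loop
   counters, 8 is the current vertex of the backward walk, 9 to 11 are the
   search flag and the edge found, 12 accumulates multiples of n.
   Arrays: 1 holds the row offsets u * n, 2 the reachability matrix, 3 marks the
   vertices still to be linked to the smallest vertex of their component, 4 holds
   the edges added by walks, 5 the demands already served. *)

(* With [c = true] all matrices are read transposed and edges are output
   reversed, that is, the program works on the reverse graph. *)
Definition offset (c : bool) (x y : nat) : expr :=
  if c then Add (Get 1 (Var y)) (Var x) else Add (Get 1 (Var x)) (Var y).
Definition cell (c : bool) (a x y : nat) : expr := Get a (offset c x y).
Definition out (c : bool) (x y : nat) : prog :=
  if c then Out (Var y) (Var x) else Out (Var x) (Var y).

(** Multiplication is not primitive, so the row offsets come from repeated addition. *)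
Definition rows : prog :=
  Then (Let 12 (Const 0))
       (For 4 (Then (Store 1 (Var 4) (Var 12)) (Let 12 (Add (Var 12) (Var 0))))).

Definition saturate_round : prog :=
  For 4 (For 5 (For 6
    (tests [:: cell false 2 4 5; cell false 0 5 6]
      (Store 2 (offset false 4 6) (Const 1))))).

Definition saturate : prog :=
  Then (For 4 (Store 2 (offset false 4 4) (Const 1))) (For 7 saturate_round).

Definition mark : prog :=
  For 4 (For 5
    (tests [:: Leq (Add (Var 4) (Const 1)) (Var 5); cell false 2 4 5; cell false 2 5 4]
      (Store 3 (Var 5) (Const 1)))).

(** Grows a tree from the smallest vertex of each component: an edge is output when it leads from an
    unmarked vertex to a marked one, whose mark is then removed. *)
Definition link_round (c : bool) : prog :=
  For 4 (For 5
    (tests [:: cell c 0 4 5; cell false 2 4 5; cell false 2 5 4;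
               Equ (Get 3 (Var 4)) (Const 0); Get 3 (Var 5)]
      (Then (Store 3 (Var 5) (Const 0)) (out c 4 5)))).

Definition link (c : bool) : prog := Then mark (For 7 (link_round c)).

Definition init : prog :=
  Then rows (Then saturate (Then (link false) (Then (link true) (Let 3 (Const 1))))).

Definition src (c : bool) : nat := if c then 2 else 1.
Definition dst (c : bool) : nat := if c then 1 else 2.

(* By the last test an edge already in H replaces any edge found before, whereas a
   new edge is only kept if it is the first one found. *)
Definition search (c : bool) : prog :=
  Then (Let 9 (Const 0))
  (For 4 (For 5
    (tests [:: cell c 0 4 5; cell c 2 (src c) 4; cell c 2 5 8; cell c 2 8 5;
               Equ (cell c 2 8 4) (Const 0); Leq (Var 9) (cell false 4 4 5)]
      (Then (Let 10 (Var 4)) (Then (Let 11 (Var 5)) (Let 9 (Const 1))))))).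

Definition record_edge (c : bool) : prog :=
  Test (Equ (cell false 4 10 11) (Const 0))
       (Then (Store 4 (offset false 10 11) (Const 1)) (out c 10 11)).

Definition step (c : bool) : prog :=
  Then (search c) (Then (record_edge c) (Let 8 (Var 10))).

(** The source always reaches the current vertex, so the test asks whether the two lie in different
    components. Once they share one, the remaining rounds do nothing. *)
Definition walk (c : bool) : prog :=
  Then (Let 8 (Var (dst c)))
       (For 7 (Test (Equ (cell c 2 8 (src c)) (Const 0)) (step c))).

(** The same command runs at every arrival, so the first one triggers the initialisation. Skipping
    repeated demands ensures that all edges logged for a pair come from a single walk, as [follows]
    requires. *)
Definition serve_demand (c : bool) : prog :=
  Then (Test (Equ (Var 3) (Const 0)) init)
       (tests [:: Equ (cell false 5 (src c) (dst c)) (Const 0);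
                  cell c 2 (src c) (dst c)]
         (Then (walk c) (Store 5 (offset false (src c) (dst c)) (Const 1)))).

Lemma serve_demand_wf c : well_formed (serve_demand c).
Proof. by case: c. Qed.

(** * Correctness *)

Section Correctness.
Variables (n : nat) (E : rel 'I_n).

Definition pos (c : bool) (u v : 'I_n) : nat := if c then v * n + u else u * n + v.

Lemma eq_pos c u v u' v' :
  (pos c u v == pos c u' v') = (u == u') && (v == v').
Proof.
have inj (a b a' b' : 'I_n) : (a * n + b == a' * n + b') = (a == a') && (b == b').
  apply/eqP/andP=> [eq|[/eqP-> /eqP->] //].
  have n0 : 0 < n by apply: leq_ltn_trans (ltn_ord a).
    have eqa : a = a' :> nat.
      have := congr1 (divn^~ n) eq.
      by rewrite !divnMDl // !divn_small // !addn0.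
    by split; apply/eqP/val_inj => //; apply: (@addnI (a * n)); rewrite {2}eqa.
by case: c; rewrite /= inj // andbC.
Qed.

Definition orient (c : bool) (e : rel 'I_n) : rel 'I_n :=
  [rel u v | if c then e v u else e u v].

Lemma connect_orient c (e : rel 'I_n) u v :
  connect (orient c e) u v = orient c (connect e) u v.
Proof.
case: c; rewrite /orient /=.
  exact: (connect_rev e u v).
by apply: eq_connect.
Qed.

Definition loaded (st : state) : Prop :=
  [/\ vars st 0 = n,
      forall u v, arrays st 0 (pos false u v) = E u v
    & forall u : 'I_n, arrays st 1 u = u * n].

Lemma loaded_frame p st st' :
    well_formed p -> 0 \notin stored p -> 1 \notin stored p ->
  frame p st st' -> loaded st -> loaded st'.
Proof.
move=> wf s0 s1 [v a _] [vn ae ar]; split=> [|u w|u].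
- by rewrite v ?well_formed_keeps0.
- by rewrite a.
- by rewrite a.
Qed.

Lemma eval_offset st c x y (u v : 'I_n) :
    loaded st -> vars st x = u -> vars st y = v ->
  eval st (offset c x y) = pos c u v.
Proof. by case=> _ _ row vx vy; case: c; rewrite /offset /= vx vy row. Qed.

Lemma eval_cell st c a x y (u v : 'I_n) :
    loaded st -> vars st x = u -> vars st y = v ->
  eval st (cell c a x y) = arrays st a (pos c u v).
Proof. by move=> ld vx vy; rewrite /cell /= (eval_offset c ld vx vy). Qed.

Lemma loaded_cell st c x y (u v : 'I_n) :
    loaded st -> vars st x = u -> vars st y = v ->
  eval st (cell c 0 x y) = orient c E u v.
Proof.
move=> ld vx vy; have [_ adj _] := ld.
by rewrite (eval_cell c 0 ld vx vy); case: c; rewrite -adj.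
Qed.

(* Keeps [/=] from unfolding the addressing of matrix entries. *)
Global Opaque offset cell.

Lemma adjacencyE (u v : 'I_n) : adjacency E (u * n + v) = E u v.
Proof.
rewrite /adjacency; congr nat_of_bool; apply/existsP/idP => [[u']|uv].
  by case/existsP=> v' /andP[]; rewrite (eq_pos false) => /andP[/eqP-> /eqP->].
by exists u; apply/existsP; exists v; rewrite eqxx.
Qed.

Lemma run_rows st :
  vars st 0 = n -> arrays st 0 = adjacency E -> loaded (run rows st).
Proof.
move=> vn adj; have [v a _] := frame_run rows st; split.
- by rewrite v.
- by move=> u w; rewrite a // adj; apply: adjacencyE.
pose I k st' := vars st' 12 = k * n /\ forall u : 'I_n, u < k -> arrays st' 1 u = u * n.
have [_ row] : I n (run rows st).
  rewrite /rows run_then; apply: run_for => // i st' vi fr [v12 row].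
  have v0 : vars st' 0 = n by have [-> //] := fr.
  split=> [|u]; rewrite /= /upd /= ?v0 ?v12 ?vi ?mulSn 1?addnC //.
  rewrite ltnS leq_eqVlt; case: eqP => [-> //|_ /= /row //].
by move=> u; apply: row.
Qed.

Definition reached (st : state) (u v : 'I_n) : nat := arrays st 2 (pos false u v).

(** A round may use entries set earlier in the same round, so path lengths are not tracked exactly:
    entries stay sound, and known paths are extended by at least one edge. *)
Lemma run_saturate_round st : loaded st ->
    (forall u v, reached st u v <= connect E u v) ->
  let st' := run saturate_round st in
  [/\ forall u v, reached st' u v <= connect E u v,
      forall u v, 0 < reached st u v -> 0 < reached st' u v
    & forall u v w, 0 < reached st u v -> E v w -> 0 < reached st' u w].
Proof.
move=> ld sound.
pose le st1 st2 :=
  (forall u v, 0 < reached st1 u v -> 0 < reached st2 u v) /\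
  ((forall u v, reached st1 u v <= connect E u v) ->
   (forall u v, reached st2 u v <= connect E u v)).
have le_trans st1 st2 st3 : le st1 st2 -> le st2 st3 -> le st1 st3.
  by move=> [h1 k1] [h2 k2]; split=> [u v /h1/h2|/k1/k2].
pose Q u st' := forall v w, 0 < reached st u v -> E v w -> 0 < reached st' u w.
have [] : le st (run saturate_round st) /\ forall u, Q u (run saturate_round st).
  apply: (run_for_grow le_trans (Q := Q)) => //.
  - by move=> u st1 st2 [h _] Q1 v w uv vw; apply/h/(Q1 v).
  - by have [] := ld.
  move=> u st1 v4 fr1 le1.
  have ld1 : loaded st1 by apply: loaded_frame fr1 ld.
  apply: (run_for2_grow le_trans (Q := fun v w st' =>
    0 < reached st u v -> E v w -> 0 < reached st' u w)) => //.
  - by move=> v w st2 st3 [h _] Q1 uv vw; apply/h/Q1.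
  - by have [] := ld1.
  move=> v w st2 v5 v6 fr2 le2.
  have ld2 : loaded st2 by apply: loaded_frame fr2 ld1.
  have {}v4 : vars st2 4 = u by have [->] := fr2.
  have le02 : le st st2 by apply: le_trans le1 le2.
  rewrite run_tests /= (eval_cell false 2 ld2 v4 v5) (loaded_cell false ld2 v5 v6).
  rewrite -[orient false E v w]/(E v w) -/(reached st2 u v) bool_neq0 andbT.
  have le22 : le st2 st2 by split.
  case: ifP => [/andP[uv vw]|no]; last first.
    by split=> // /le02.1 uv vw; rewrite vw andbT -lt0n uv in no.
  rewrite (eval_offset false ld2 v4 v6).
  have new a b : reached (set_array 2 (pos false u w) 1 st2) a b =
      if (a == u) && (b == w) then 1 else reached st2 a b.
    by rewrite -(eq_pos false).
  split; last by move=> _ _; rewrite new !eqxx.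
  split=> [a b|sd a b]; rewrite new; case: ifP => // /andP[/eqP-> /eqP->].
  rewrite lt0b; apply: connect_trans (connect1 vw).
  by have := sd u v; case: connect => //; rewrite leqn0 (negPf uv).
by move=> [mono snd] Q1; split=> //; apply: snd.
Qed.

Lemma short_path (e : rel 'I_n) u v : connect e u v ->
  exists p, [/\ path e u p, last u p = v & size p <= n].
Proof.
case/connectP=> p /shortenP[p' ep' up' _] ->; exists p'; split=> //.
have := card_uniqP up'; rewrite /= => szp.
by rewrite ltnW // -szp -[X in _ <= X]card_ord max_card.
Qed.

Lemma run_saturate st : loaded st -> (forall u v, reached st u v = 0) ->
  forall u v, reached (run saturate st) u v = connect E u v.
Proof.
move=> ld zero; rewrite /saturate run_then; set st1 := run (For 4 _) st.
have ld1 : loaded st1 by apply: loaded_frame ld; last exact: frame_run.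
have [sound1 diag] : (forall u v, reached st1 u v <= connect E u v) /\
    forall u, 0 < reached st1 u u.
  pose I k st' := (forall u v, reached st' u v <= (u == v)) /\
    forall u : 'I_n, u < k -> 0 < reached st' u u.
  suff [le1 diag1] : I n st1.
    split=> [u v|u]; last exact: diag1.
    by apply: leq_trans (le1 u v) _; case: eqP => // ->; rewrite connect0.
  apply: run_for => //; first by have [] := ld.
    by split=> // u v; have := zero u v; rewrite /reached /= => ->.
  move=> i st2 v4 fr [le2 diag2].
  have ld2 : loaded st2 by apply: loaded_frame fr ld.
  have new a b : reached (set_array 2 (pos false i i) 1 st2) a b =
      if (a == i) && (b == i) then 1 else reached st2 a b.
    by rewrite -(eq_pos false).
  rewrite /= (eval_offset false ld2 v4 v4); split=> [u v|u lt].
    change (reached (set_array 2 (pos false i i) 1 st2) u v <= (u == v)).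
    by rewrite new; case: ifP => [/andP[/eqP-> /eqP->]|_]; rewrite ?eqxx.
  change (0 < reached (set_array 2 (pos false i i) 1 st2) u u).
  rewrite new; case: eqP => //= ne; apply: diag2.
  by move: lt; rewrite ltnS leq_eqVlt => /predU1P[/val_inj|].
(* After k rounds all paths with at most k edges are recorded; n rounds suffice by [short_path]. *)
pose I k st' := (forall u v, reached st' u v <= connect E u v) /\
  forall u p, path E u p -> size p <= k -> 0 < reached st' u (last u p).
have [sound short] : I n (run (For 7 saturate_round) st1).
  apply: run_for => //; first by have [] := ld1.
    by split=> // u [|v p] // _ _; apply: diag.
  move=> k st2 v7 fr [sound2 short2].
  have ld2 : loaded st2 by apply: loaded_frame fr ld1.
  have [sound3 mono3 step3] := run_saturate_round ld2 sound2.
  split=> // u p; case/lastP: p => [|p v].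
    by move=> _ _; apply/mono3/(short2 u [::]).
  rewrite rcons_path last_rcons size_rcons => /andP[up pv] szp.
  by apply: step3 pv; apply: short2.
move=> u v; have := sound u v; case: (boolP (connect E u v)) => [uv|_].
  by have [p [up <- szp]] := short_path uv; move=> le1; apply/eqP; rewrite eqn_leq le1; apply: short.
by rewrite leqn0 => /eqP.
Qed.

End Correctness.

(** * Spanning trees inside the components *)

Section Link.
Variables (n : nat) (E : rel 'I_n).

Definition known (st : state) : Prop :=
  loaded E st /\ forall u v : 'I_n, reached st u v = connect E u v.

Lemma known_frame p st st' :
    well_formed p -> all [pred a | a \notin stored p] [:: 0; 1; 2] ->
  frame p st st' -> known st -> known st'.
Proof.
move=> wf /and4P[s0 s1 s2 _] fr [ld rc]; split; first exact: loaded_frame fr ld.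
by move=> u v; have [_ a _] := fr; rewrite -rc /reached a.
Qed.

Lemma known_cell st c x y (u v : 'I_n) :
    known st -> vars st x = u -> vars st y = v ->
  eval st (cell c 2 x y) = connect (orient c E) u v.
Proof.
move=> [ld rc] vx vy; rewrite (eval_cell c 2 ld vx vy) connect_orient.
by case: c; rewrite /orient /= -rc.
Qed.

Lemma known_cell0 st x y (u v : 'I_n) :
    known st -> vars st x = u -> vars st y = v ->
  eval st (cell false 2 x y) = connect E u v.
Proof. exact: known_cell. Qed.

Definition output_rel (em : seq (nat * nat)) : rel 'I_n :=
  [rel u v | (val u, val v) \in em].

Lemma connect_output c (em em' : seq (nat * nat)) u v : {subset em <= em'} ->
  connect (orient c (output_rel em)) u v -> connect (orient c (output_rel em')) u v.
Proof.
move=> sub; apply: connect_sub => x y xy; apply: connect1.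
by case: c xy; rewrite /orient /= => /sub.
Qed.

Lemma run_mark st : known st -> (forall v : 'I_n, arrays st 3 v = 0) ->
  forall v : 'I_n, arrays (run mark st) 3 v = [exists u : 'I_n, (u < v) && scc E u v].
Proof.
move=> kn zero; pose m (v : 'I_n) := [exists u : 'I_n, (u < v) && scc E u v].
pose le st1 st2 :=
  (forall v : 'I_n, 0 < arrays st1 3 v -> 0 < arrays st2 3 v) /\
  ((forall v : 'I_n, arrays st1 3 v <= m v) -> forall v : 'I_n, arrays st2 3 v <= m v).
have le_trans st1 st2 st3 : le st1 st2 -> le st2 st3 -> le st1 st3.
  by move=> [h1 k1] [h2 k2]; split=> [v /h1/h2|/k1/k2].
pose Q (u v : 'I_n) st' := u < v -> scc E u v -> 0 < arrays st' 3 v.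
have [] : le st (run mark st) /\ forall u v, Q u v (run mark st).
  apply: (run_for2_grow le_trans (Q := Q)) => //.
  - by move=> u v st1 st2 [h _] Q1 uv uv'; apply/h/Q1.
  - by have [[]] := kn.
  move=> u v st1 v4 v5 fr le1.
  have kn1 : known st1 by apply: known_frame fr kn.
  rewrite run_tests /= (known_cell0 kn1 v4 v5) (known_cell0 kn1 v5 v4).
  rewrite v4 v5 addn1 !bool_neq0 andbT; case: ifP => [/andP[lt eq]|no].
    split; last by move=> _ _; rewrite /= /upd /= eqxx.
    split=> [w|le2 w]; rewrite /= /upd /=; case: eqP => // /val_inj->.
    by rewrite lt0b; apply/existsP; exists u; rewrite lt.
  by split=> // lt eq; move: no; rewrite lt; case/andP: eq => -> ->.
move=> [_ le1] Q1 v.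
have {}le1 : arrays (run mark st) 3 v <= m v by apply: le1 => w; rewrite zero.
apply/eqP; rewrite eqn_leq le1 /=; case: existsP => // -[u /andP[lt eq]].
exact: Q1 lt eq.
Qed.

Definition unlinked (st : state) : nat := \sum_(v < n) arrays st 3 v.

Definition smallest (r : 'I_n) : Prop := forall u : 'I_n, scc E r u -> r <= u.

(** Every output edge is paid for by a removed mark, which keeps the third clause true. By the last
    clause, unmarked vertices are already attached to the smallest vertex of their component. *)
Definition linking (c : bool) (B : nat) (st : state) : Prop :=
  [/\ forall v : 'I_n, arrays st 3 v <= 1,
      sound_output E st,
      size (emitted st) + unlinked st <= B
    & forall r v : 'I_n, smallest r -> scc E r v -> arrays st 3 v = 0 ->
        connect (orient c (output_rel (emitted st))) r v].

Lemma linking_add c B st (u v : 'I_n) :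
    orient c E u v -> scc E u v -> arrays st 3 u = 0 -> arrays st 3 v != 0 ->
    linking c B st ->
  linking c B (if c then emit v u (set_array 3 v 0 st) else emit u v (set_array 3 v 0 st)).
Proof.
move=> uv euv u0 v0 [le1 snd szB con].
set st' := if c then _ else _.
have U w : arrays st' 3 w = if w == v then 0 else arrays st 3 w by rewrite /st'; case: (c).
pose e : nat * nat := if c then (val v, val u) else (val u, val v).
have em : emitted st' = e :: emitted st by rewrite /st' /e; case: (c).
have sub : {subset emitted st <= emitted st'} by move=> x; rewrite em inE orbC => ->.
split.
- by move=> w; rewrite U; case: ifP.
- move=> x y; rewrite em inE => /predU1P[|/snd //].
  by rewrite /e; case: (c) uv => /= uv [-> ->]; [exists v, u|exists u, v].
- have -> : unlinked st' = unlinked st - 1.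
    rewrite /unlinked (bigD1 v) //= [in RHS](bigD1 v) //= U eqxx.
    have -> : arrays st 3 v = 1 by have := le1 v; move: v0; lia.
    by rewrite addKn; apply: eq_bigr => w wv; rewrite U -[_ == _ :> nat]/(w == v) (negPf wv).
  have : 0 < unlinked st by rewrite /unlinked (bigD1 v) //= addn_gt0 lt0n v0.
  by rewrite em /=; lia.
move=> r w rr rw; rewrite U; case: eqP => [/val_inj wv _|_ w0]; last first.
  exact: connect_output sub (con r w rr rw w0).
have ru : scc E r u by apply: scc_trans rw _; rewrite wv scc_sym.
rewrite wv; apply: connect_trans (connect_output sub (con r u rr ru u0)) (connect1 _).
by rewrite em /e; case: (c); exact: mem_head.
Qed.

Lemma run_link_round c B st : known st -> linking c B st ->
  let st' := run (link_round c) st in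
  [/\ linking c B st', {subset emitted st <= emitted st'},
      forall v : 'I_n, arrays st 3 v = 0 -> arrays st' 3 v = 0
    & forall u v : 'I_n, orient c E u v -> scc E u v ->
        arrays st 3 u = 0 -> arrays st' 3 v = 0].
Proof.
move=> kn lk.
pose le st1 st2 := [/\ linking c B st1 -> linking c B st2,
  {subset emitted st1 <= emitted st2}
  & forall v : 'I_n, arrays st1 3 v = 0 -> arrays st2 3 v = 0].
have le_trans st1 st2 st3 : le st1 st2 -> le st2 st3 -> le st1 st3.
  by move=> [l1 s1 z1] [l2 s2 z2]; split=> [/l1/l2|x /s1/s2|v /z1/z2].
pose Q (u v : 'I_n) st' := orient c E u v -> scc E u v ->
  arrays st 3 u = 0 -> arrays st' 3 v = 0.
have [] : le st (run (link_round c) st) /\ forall u v, Q u v (run (link_round c) st).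
  apply: (run_for2_grow le_trans (Q := Q)).
  - by move=> k st'; split.
  - by move=> k st'; split.
  - by move=> u v st1 st2 [_ _ z] Q1 uv uv' u0; apply/z/Q1.
  - by have [[]] := kn.
  - by case: (c).
  move=> u v st1 v4 v5 fr le1.
  have kn1 : known st1 by apply: known_frame fr kn; case: (c).
  rewrite run_tests /= (known_cell0 kn1 v4 v5) (known_cell0 kn1 v5 v4).
  rewrite (loaded_cell c kn1.1 v4 v5) v4 v5 !bool_neq0 andbT.
  case: ifP => [/and5P[uv uv1 uv2 /eqP u0 v0]|no]; last first.
    split; first by split.
    move=> uv /andP[uv1 uv2] u0; move: no; rewrite uv uv1 uv2.
    by have [_ _ z] := le1; rewrite z //=; case: eqP.
  have := @linking_add c B st1 u v uv _ u0 v0; rewrite /scc /= uv1 uv2 => /(_ isT) add.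
  have -> : run (out c 4 5) (set_array 3 v 0 st1) =
      if c then emit v u (set_array 3 v 0 st1) else emit u v (set_array 3 v 0 st1).
    by rewrite /out; case: (c); rewrite /= v4 v5.
  set st2 := if c then _ else _ in add *.
  have U w : arrays st2 3 w = if w == v then 0 else arrays st1 3 w.
    by rewrite /st2; case: (c).
  split=> [|_ _ _]; last by rewrite U eqxx.
  split=> // [x|w w0]; first by rewrite /st2; case: (c); rewrite inE orbC => ->.
  by rewrite U w0 if_same.
by move=> [lk' sub z] Q1; split=> //; apply: lk'.
Qed.

Lemma run_link c st : known st -> (forall v : 'I_n, arrays st 3 v = 0) ->
    sound_output E st ->
  let st' := run (link c) st in
  [/\ forall v : 'I_n, arrays st' 3 v = 0,
      sound_output E st',
      {subset emitted st <= emitted st'},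
      size (emitted st') <= size (emitted st) + n
    & forall r v : 'I_n, smallest r -> scc E r v ->
        connect (orient c (output_rel (emitted st'))) r v].
Proof.
move=> kn zero snd; rewrite /link run_then; set st1 := run mark st.
have fr1 : frame mark st st1 by apply: frame_run.
have U1 := run_mark kn zero; rewrite -/st1 in U1.
have kn1 : known st1 by apply: known_frame fr1 kn.
have em1 : emitted st1 = emitted st by have [_ _ ->] := fr1.
have root r : smallest r -> arrays st1 3 r = 0.
  move=> small; rewrite U1; case: existsP => // -[u /andP[lt ur]].
  by rewrite scc_sym in ur; have := small u ur; rewrite leqNgt lt.
have rootP (r : 'I_n) : arrays st1 3 r = 0 -> smallest r.
  rewrite U1; case: existsP => // none _ u ru; rewrite leqNgt; apply/negP=> lt.
  by apply: none; exists u; rewrite lt scc_sym.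
pose B := size (emitted st) + n.
have lk1 : linking c B st1.
  split.
  - by move=> v; rewrite U1 leq_b1.
  - by move=> x y; rewrite em1; apply: snd.
  - rewrite em1 leq_add2l /unlinked -[X in _ <= X]card_ord -sum1_card.
    by apply: leq_sum => v _; rewrite U1 leq_b1.
  (* At first the unmarked vertices are exactly the roots, so [v] is [r] itself. *)
  move=> r v rr rv /rootP rv'; suff -> : r = v by rewrite connect0.
  apply/val_inj/eqP; rewrite eqn_leq rr //=.
  by apply: rv'; rewrite scc_sym.
(* After k rounds the ends of all paths of at most k edges from a root within its component are
   unmarked. *)
pose I k st' := [/\ linking c B st', {subset emitted st <= emitted st'}
  & forall r p, smallest r -> path (orient c E) r p -> scc E r (last r p) ->
      size p <= k -> arrays st' 3 (last r p) = 0].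
have [[U' snd' sz' con] sub z] : I n (run (For 7 (link_round c)) st1).
  apply: run_for.
  - by have [[]] := kn1.
  - by case: (c).
  - split=> //; first by move=> x; rewrite /= em1.
    by move=> r [|//] rr _ _ _; apply: root.
  move=> k st2 v7 fr [lk2 sub2 z2].
  have kn2 : known st2 by apply: known_frame fr kn1; case: (c).
  have [lk3 sub3 z3 st3] := run_link_round kn2 lk2.
  split=> // [x /sub2/sub3 //|r p rr].
  case/lastP: p => [|p v]; first by move=> _ _ _; apply/z3/(z2 r [::]); rewrite //= scc_refl.
  rewrite rcons_path last_rcons size_rcons => /andP[rp pv] rv szp.
  have conn_rp : connect (orient c E) r (last r p) by apply/connectP; exists p.
  (* A path between two vertices of one component never leaves it. *)
  have rpv : scc E r (last r p).
    case/andP: rv => rv vr; move: conn_rp (connect1 pv).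
    rewrite !connect_orient; case: (c); rewrite /orient /= => h1 h2; apply/andP; split=> //.
      exact: connect_trans rv h2.
    exact: connect_trans h2 vr.
  have pv' : scc E (last r p) v by apply: scc_trans rv; rewrite scc_sym.
  by apply: st3 pv pv' _; apply: z2.
set st' := run _ st1 in U' snd' sz' con sub z *.
have all0 (v : 'I_n) : arrays st' 3 v = 0.
  have [r small rv] : exists2 r, smallest r & scc E r v.
    have [r vr min] := @arg_minnP _ v (scc E v) val (scc_refl E v).
    exists r; last by rewrite scc_sym.
    by move=> u ru; apply: min; apply: scc_trans ru.
  have : connect (orient c E) r v.
    by rewrite connect_orient; case/andP: rv; case: (c).
  by case/short_path=> p [rp lp szp]; rewrite -lp; apply: z; rewrite ?lp.
split=> // [|r v rr rv]; last by apply: con => //; apply: all0.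
by move: sz'; rewrite /B; lia.
Qed.

End Link.

(** * Initialisation and the search for an entering edge *)

Section Walk.
Variables (n : nat) (E : rel 'I_n).

(** The smallest vertex of a component serves as a hub: [u] reaches it along the in-tree, and it
    reaches [v] along the out-tree. Each family of trees has at most n edges. *)
Lemma run_init st :
    vars st 0 = n -> arrays st 0 = adjacency E ->
    (forall a i, a != 0 -> arrays st a i = 0) -> emitted st = [::] ->
  let st' := run init st in
  [/\ known E st', vars st' 3 = 1, sound_output E st', size (emitted st') <= 2 * n
    & forall u v, scc E u v -> connect (output_rel (emitted st')) u v].
Proof.
move=> vn adj zero em0; rewrite /init 4!run_then.
have fr1 := frame_run rows st; have ld1 := run_rows vn adj.
set st1 := run rows st in fr1 ld1 *.
have fr2 := frame_run saturate st1.
have rc2 : forall u v, reached (run saturate st1) u v = connect E u v.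
  by apply: run_saturate => // u v; have [_ a _] := fr1; rewrite /reached a ?zero.
set st2 := run saturate st1 in fr2 rc2 *.
have kn2 : known E st2 by split=> //; apply: loaded_frame fr2 ld1.
have em2 : emitted st2 = [::].
  by have [_ _ o1] := fr1; have [_ _ o2] := fr2; rewrite o2 ?o1.
have [||U3 snd3 sub3 sz3 con3] := @run_link n E false st2 kn2.
- by move=> v; have [_ a1 _] := fr1; have [_ a2 _] := fr2; rewrite a2 ?a1 ?zero.
- by move=> x y; rewrite em2.
set st3 := run (link false) st2 in U3 snd3 sub3 sz3 con3 *.
have kn3 : known E st3 by apply: known_frame (frame_run _ _) kn2.
have [_ snd4 sub4 sz4 con4] := @run_link n E true st3 kn3 U3 snd3.
set st4 := run (link true) st3 in snd4 sub4 sz4 con4 *.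
have kn4 : known E st4 by apply: known_frame (frame_run _ _) kn3.
split=> //; first by rewrite em2 in sz3; rewrite /=; move: sz3 sz4 => /=; lia.
move=> u v uv.
have [r small ru] : exists2 r, smallest E r & scc E r u.
  have [r ur min] := @arg_minnP _ u (scc E u) val (scc_refl E u).
  exists r; last by rewrite scc_sym.
  by move=> w rw; apply: min; apply: scc_trans rw.
have := con4 r u small ru; rewrite connect_orient => ur.
apply: connect_trans ur _.
by apply: (@connect_output _ false _ _ _ _ sub4); apply: con3 => //; apply: scc_trans uv.
Qed.

(** As [u] reaches [x] through [v], the last clause says that [u] lies outside the component of
    [x]. *)
Definition eligible (G : rel 'I_n) (s x u v : 'I_n) : bool :=
  [&& G u v, connect G s u, connect G v x, connect G x v & ~~ connect G x u].

(** On a path from [s] to [x], take the first edge whose head is reachable from [x]. *)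
Lemma eligible_exists (G : rel 'I_n) s x :
  connect G s x -> ~~ connect G x s -> exists u v, eligible G s x u v.
Proof.
case/connectP=> p; elim: p s => [|y p IHp] s /=.
  by move=> _ ->; rewrite connect0.
case/andP=> sy yp lx xs; have yx : connect G y x by apply/connectP; exists p.
have [xy|xy] := boolP (connect G x y).
  by exists s, y; rewrite /eligible sy connect0 yx xy xs.
have [u [v /and5P[uv yu vx xv xu]]] := IHp y yp lx xy.
exists u, v; apply/and5P; split=> //.
exact: connect_trans (connect1 sy) yu.
Qed.

Lemma run_search c st (s x : 'I_n) (h : rel 'I_n) :
    known E st -> vars st (src c) = s -> vars st 8 = x ->
    (forall u v, arrays st 4 (pos false u v) = h u v) ->
    (exists u v, eligible (orient c E) s x u v) ->
  let st' := run (search c) st in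
  exists u v : 'I_n, [/\ vars st' 10 = u, vars st' 11 = v,
    eligible (orient c E) s x u v &
    forall u' v', eligible (orient c E) s x u' v' -> h u' v' -> h u v].
Proof.
move=> kn vs vx hh ex; rewrite /search run_then; set st0 := run (Let 9 _) st.
set G := orient c E in ex *.
pose I st' := vars st' 9 = 0 \/ vars st' 9 = 1 /\ exists u v : 'I_n,
  [/\ vars st' 10 = u, vars st' 11 = v & eligible G s x u v].
pose J st' := exists u v : 'I_n, [/\ vars st' 10 = u, vars st' 11 = v & h u v].
(* The third clause is conditional because before the first find registers 10 and 11 hold stale
   values, which may satisfy [J] by accident. *)
pose le st1 st2 := [/\ I st1 -> I st2, vars st1 9 = 1 -> vars st2 9 = 1
  & vars st1 9 = 1 -> J st1 -> J st2].
have le_trans st1 st2 st3 : le st1 st2 -> le st2 st3 -> le st1 st3.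
  by move=> [i1 f1 j1] [i2 f2 j2]; split=> [/i1/i2|/f1/f2|f /(j1 f)/(j2 (f1 f))].
pose Q u v st' := eligible G s x u v -> vars st' 9 = 1 /\ (h u v -> J st').
set p := For 4 _.
have kn0 : known E st0 by apply: known_frame (frame_run _ _) kn.
have [[I1 _ _] Q1] : le st0 (run p st0) /\ forall u v, Q u v (run p st0).
  apply: (run_for2_grow le_trans (Q := Q)).
  - by move=> k st'; split.
  - by move=> k st'; split.
  - move=> u v st1 st2 [_ f j] Q1 el; have [f1 j1] := Q1 el.
    by split=> [|/j1]; [apply: f|apply: j].
  - by have [[]] := kn.
  - by case: (c).
  move=> u v st1 v4 v5 fr le1.
  have kn1 : known E st1 by apply: known_frame fr kn0; case: (c).
  have [va aa _] := fr.
  have v8 : vars st1 8 = x by rewrite va //; case: (c).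
  have vs1 : vars st1 (src c) = s by rewrite va; [case: (c) vs|case: (c)].
  rewrite run_tests /= (loaded_cell c kn1.1 v4 v5) -/G.
  rewrite (known_cell c kn1 vs1 v4) (known_cell c kn1 v5 v8) (known_cell c kn1 v8 v5).
  rewrite (known_cell c kn1 v8 v4) (eval_cell false 4 kn1.1 v4 v5) -/G aa //.
  have -> : arrays st0 4 (pos false u v) = h u v by exact: hh.
  have I1 : I st1 by case: le1 => i _ _; apply: i; left.
  have -> : forall b : bool, [&& (G u v : nat) != 0, (connect G s u : nat) != 0,
      (connect G v x : nat) != 0, (connect G x v : nat) != 0,
      ((connect G x u : nat) == 0 : nat) != 0, (b : nat) != 0 & true] =
      eligible G s x u v && b.
    by move=> b; rewrite /eligible !bool_neq0 andbT eqb0 -!andbA.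
  case: ifP => [/andP[el fh]|no].
    (* Once the flag is set, the last test lets only edges of [h] replace the one found. *)
    have f1 : vars st1 9 = 1 -> h u v by move=> f; move: fh; rewrite f; case: (h u v).
    split; last by move=> _; split=> //= huv; exists u, v; split.
    split=> [_|_|/f1 huv _] //; last by exists u, v; split.
    by right; split=> //; exists u, v; split.
  split; first by split.
  move=> el; move: no; rewrite el /=; case: I1 => [->|[-> _]]; first by [].
  by case: (h u v).
case: ex => u0 [v0 el0]; have [f _] := Q1 u0 v0 el0.
have [|[_ [u [v [v10 v11 el]]]]] : I (run p st0) by apply: I1; left.
  by rewrite f.
exists u, v; split=> // u' v' el' h'; have [_ /(_ h') [u1 [v1 [w10 w11]]]] := Q1 u' v' el'.
have -> : u1 = u by apply: val_inj; rewrite -[LHS]w10 -[RHS]v10.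
by have -> : v1 = v by apply: val_inj; rewrite -[LHS]w11 -[RHS]v11.
Qed.

End Walk.

(** * The backward walk for one demand *)

Section Serve.
Variables (n : nat) (E : rel 'I_n) (c : bool).

Let G : rel 'I_n := orient c E.
Definition output_reach (st : state) : rel 'I_n :=
  connect (orient c (output_rel (emitted st))).

Lemma scc_orient u v : scc G u v = scc E u v.
Proof.
rewrite /scc /= !connect_orient /orient /=; case: (c) => //.
by rewrite andbC.
Qed.

(** The log [L] exists only in the proof; array 4 keeps its edges without their demands. The term 2n
    accounts for the trees inside the components. *)
Record growing (L : seq (entry n)) (st : state) : Prop := Growing {
  growing_known : known E st;
  growing_sound : sound_output E st;
  growing_size : size (emitted st) <= size L + 2 * n;
  growing_scc : forall u v, scc G u v -> output_reach st u v;
  growing_log : growth_log G L;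
  growing_array : forall u v, arrays st 4 (pos false u v) = ((u, v) \in map snd L);
  growing_output : forall u v, (u, v) \in map snd L -> orient c (output_rel (emitted st)) u v
}.

Lemma growing_frame p st st' L :
    well_formed p -> all [pred a | a \notin stored p] [:: 0; 1; 2; 4] -> silent p ->
  frame p st st' -> growing L st -> growing L st'.
Proof.
move=> wf /and5P[s0 s1 s2 s4 _] sil fr [kn snd sz con log arr outp].
have [va aa oo] := fr; have em := oo sil; split=> //.
- by apply: known_frame fr kn => //; apply/and4P; split.
- by move=> x y; rewrite em; apply: snd.
- by rewrite em.
- by move=> u v; rewrite /output_reach em; apply: con.
- by move=> u v; rewrite aa.
- by move=> u v; rewrite em; apply: outp.
Qed.

(** When the chosen edge is new, the preference for old edges shows that no logged edge is eligible;
    this gives the first clause of [follows] for the new entry, and the last hypothesis gives the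
    second. *)
Lemma run_record st L (s t x u v : 'I_n) :
    growing L st -> vars st 10 = u -> vars st 11 = v ->
    eligible G s x u v ->
    (forall u' v', eligible G s x u' v' -> (u', v') \in map snd L -> (u, v) \in map snd L) ->
    {in L, forall b, b.1 = (s, t) -> connect G x b.2.1} ->
  exists L', let st' := run (record_edge c) st in
    [/\ growing L' st', {subset emitted st <= emitted st'},
        (u, v) \in map snd L' &
        L' = L \/ L' = ((s, t), (u, v)) :: L].
Proof.
move=> gr vu vv el pref far; have kn := growing_known gr.
rewrite /= (eval_cell false 4 kn.1 vu vv) (growing_array gr).
have [inL|notL] := boolP ((u, v) \in map snd L).
  by exists L; split=> //; left.
exists (((s, t), (u, v)) :: L); rewrite /=.
set st1 := run _ _.
have [uv su vx xv xu] := and5P el.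
pose e : nat * nat := if c then (val v, val u) else (val u, val v).
have em : emitted st1 = e :: emitted st.
  by rewrite /st1 /e /out; case: (c); rewrite /= ?vu ?vv.
have sub : {subset emitted st <= emitted st1} by move=> y; rewrite em inE orbC => ->.
have arr u' v' : arrays st1 4 (pos false u' v') =
    if (u' == u) && (v' == v) then 1 else arrays st 4 (pos false u' v').
  have -> : arrays st1 = arrays (set_array 4 (pos false u v) 1 st).
    by rewrite /st1 /out (eval_offset false kn.1 vu vv); case: (c).
  by rewrite -(eq_pos false).
split=> //; [|by rewrite mem_head|by right]; split.
- have [[vn adj row] rc] := kn; split; [split|].
  + by rewrite -vn /st1 /out; case: (c).
  + by move=> u' v'; rewrite -adj /st1 /out; case: (c).
  + by move=> u'; rewrite -row /st1 /out; case: (c).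
  + by move=> u' v'; rewrite -rc /st1 /out; case: (c).
- have snd := growing_sound gr; move=> y z; rewrite em inE => /predU1P[|]; last exact: snd.
  rewrite /e; move: uv; rewrite /G /orient /=.
  by case: (c) => uv [-> ->]; [exists v, u|exists u, v].
- by rewrite em /= ltnS; apply: growing_size gr.
- by move=> y z /(growing_scc gr); apply: connect_output.
- have /andP[/allP ok pw] := growing_log gr; apply/andP; split.
    rewrite /= uv su; apply/andP; split; last exact/allP.
    by apply: contra xu; apply: connect_trans.
  rewrite /= pw andbT; apply/allP => -[[s' t'] [u' v']] bL; apply/andP; split.
    (* An older edge into the same component with tail reachable from [s] would be eligible, so
       [pref] would put [(u, v)] in the log. *)
    apply/implyP => /andP[vv' v'v]; apply: contra notL => su'.
    apply: (pref u' v'); last by apply/mapP; exists ((s', t'), (u', v')).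
    have /and3P[uv' _ nvu'] := ok _ bL.
    apply/and5P; split=> //.
    + exact: connect_trans v'v vx.
    + exact: connect_trans xv vv'.
    + by apply: contra nvu'; apply: connect_trans; apply: connect_trans v'v vx.
  by apply/implyP => /eqP d; apply: connect_trans vx (far _ bL _).
- by move=> u' v'; rewrite arr (growing_array gr) inE xpair_eqE; case: ifP.
- move=> u' v'; rewrite inE => /predU1P[[-> ->]|/(growing_output gr)].
    by rewrite em /e; case: (c); exact: mem_head.
  by case: (c); apply: sub.
Qed.

Lemma run_step st L (s t x : 'I_n) :
    growing L st -> vars st (src c) = s -> vars st 8 = x ->
    connect G s x -> ~~ connect G x s ->
    {in L, forall b, b.1 = (s, t) -> connect G x b.2.1} ->
  let st' := run (step c) st in exists L' (u : 'I_n),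
    [/\ growing L' st', vars st' 8 = u,
       [/\ connect G s u, connect G u x & ~~ connect G x u],
       output_reach st' u x /\ {subset emitted st <= emitted st'} &
       {in L', forall b, b.1 = (s, t) -> connect G u b.2.1} /\
       {in L', forall b, b \in L \/ b.1 = (s, t)}].
Proof.
move=> gr vs vx sx xs far; rewrite /step 2!run_then.
have := @run_search n E c st s x [rel u v | (u, v) \in map snd L]
  (growing_known gr) vs vx (growing_array gr) (eligible_exists sx xs).
set st1 := run (search c) st => -[u [v [v10 v11 el pref]]].
have fr1 : frame (search c) st st1 by apply: frame_run.
have gr1 : growing L st1 by apply: growing_frame fr1 gr; case: (c).
have em1 : emitted st1 = emitted st by have [_ _ o] := fr1; apply: o; case: (c).
have [L' [gr2 sub2 inL' L'E]] := run_record gr1 v10 v11 el pref far.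
set st2 := run (record_edge c) st1 in gr2 sub2 *.
have fr2 : frame (record_edge c) st1 st2 by apply: frame_run.
have v10' : vars st2 10 = u by have [va _ _] := fr2; rewrite va // /record_edge /out; case: (c).
have [uv su vx' xv xu] := and5P el.
have ux : connect G u x by apply: connect_trans (connect1 uv) vx'.
exists L', u; split=> //.
- by apply: growing_frame (frame_run _ _) gr2.
- split=> //=; last by move=> y; rewrite -em1; apply: sub2.
  (* The output contains the edge from [u] to [v], and the trees lead on from [v] to [x] within
     their component. *)
  apply: connect_trans (connect1 (growing_output gr2 inL')) _.
  by apply: (growing_scc gr2); apply/andP.
split=> b bL'; case: L'E bL' => ->; rewrite ?inE.
- by move=> bL d; apply: connect_trans ux (far b bL d).
- case/predU1P=> [-> _|bL d]; first by rewrite connect0.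
  exact: connect_trans ux (far b bL d).
- by left.
- by case/predU1P=> [->|]; [right|left].
Qed.

Lemma run_walk st L (s t : 'I_n) :
    growing L st -> vars st (src c) = s -> vars st (dst c) = t ->
    connect G s t -> {in L, forall b, b.1 != (s, t)} ->
  let st' := run (walk c) st in exists L',
    [/\ growing L' st', output_reach st' s t, {subset emitted st <= emitted st'} &
       {in L', forall b, b \in L \/ b.1 = (s, t)}].
Proof.
move=> gr vs vt st_conn new; rewrite /walk run_then; set st1 := run _ st.
(* The set of vertices that reach the current vertex shrinks in every round. *)
pose I k st' := exists L' (x : 'I_n), [/\ growing L' st', vars st' 8 = x,
  [/\ connect G s x, output_reach st' x t & {subset emitted st <= emitted st'}],
  {in L', forall b, b.1 = (s, t) -> connect G x b.2.1} /\
  {in L', forall b, b \in L \/ b.1 = (s, t)} &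
  connect G x s \/ #|[set w | connect G w x]| + k <= n].
have gr1 : growing L st1 by apply: growing_frame (frame_run _ _) gr.
have vs1 : vars st1 (src c) = s by rewrite /= /upd; case: (c) vs.
have : I n (run (For 7 (Test (Equ (cell c 2 8 (src c)) (Const 0)) (step c))) st1).
  apply: run_for.
  - by have [[]] := growing_known gr1.
  - by case: (c).
  - exists L, t; split=> //.
    + by apply: growing_frame (frame_run (Let 7 (Const 0)) st1) gr1.
    + by split=> //; rewrite /output_reach connect0.
    (* No entry belongs to [(s, t)] yet, so the condition on tails holds vacuously. *)
    + by split=> b bL; [move/eqP; rewrite (negPf (new b bL))|left].
    by right; rewrite addn0 -[X in _ <= X]card_ord max_card.
  move=> k st2 v7 fr [L2 [x [gr2 v8 [sx xt sub2] [far2 dem2] pot]]].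
  have vs2 : vars st2 (src c) = s by have [va _ _] := fr; rewrite va; case: (c) vs1.
  set p := Test _ _.
  have setvar L3 st3 : growing L3 st3 -> growing L3 (set_var 7 k.+1 st3).
    by apply: growing_frame (frame_run (Let 7 (Const k.+1)) st3).
  rewrite /p /= (known_cell c (growing_known gr2) v8 vs2) -/G.
  have [xs|xs] := boolP (connect G x s).
    by exists L2, x; split=> //; [apply: setvar|left].
  have [L3 [u [gr3 u8 [su ux xu] [hux sub3] [far3 dem3]]]] := run_step gr2 vs2 v8 sx xs far2.
  exists L3, u; split=> //.
  + exact: setvar.
  + split=> //; last by move=> y /sub2/sub3.
    by apply: connect_trans hux _; apply: connect_output sub3 xt.
  + split=> // b /dem3[/dem2|]; auto.
  right; case: pot => [|pot]; first by rewrite (negPf xs).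
  rewrite addnS -addSn; apply: leq_trans pot; rewrite leq_add2r.
  apply: proper_card; apply/properP; split.
    by apply/subsetP => w; rewrite !inE => wu; apply: connect_trans ux.
  by exists x; rewrite !inE ?connect0.
move=> [L' [x [gr' _ [sx xt sub] [_ dem] pot]]]; exists L'; split=> //.
(* After n rounds the set would be empty although it contains [x]; so [x] is in the component of
   [s], where the trees supply the rest of the path. *)
apply: connect_trans xt; apply: (growing_scc gr'); rewrite /scc /= sx.
case: pot => // le; exfalso.
have : 0 < #|[set w | connect G w x]| by apply/card_gt0P; exists x; rewrite inE connect0.
by move: le; move: #|_| => m; lia.
Qed.

End Serve.

(** * Serving a sequence of demands *)

Section Main.
Variables (n : nat) (E : rel 'I_n) (c : bool).

Let G : rel 'I_n := orient c E.

Definition turn (d : 'I_n * 'I_n) : 'I_n * 'I_n := if c then (d.2, d.1) else d.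

Definition fresh (st : state) : Prop :=
  [/\ vars st 0 = n, vars st 3 = 0, arrays st 0 = adjacency E,
      forall a i, a != 0 -> arrays st a i = 0 & emitted st = [::]].

(** The log stores demands as seen by the oriented graph, hence [turn]. The fourth clause lets each
    new walk start with no entry for its pair. *)
Definition serving (ds : seq ('I_n * 'I_n)) (L : seq (entry n)) (st : state) : Prop :=
  [/\ growing E c L st, vars st 3 = 1,
      forall s t, arrays st 5 (pos false s t) != 0 ->
        connect G s t -> output_reach c st s t,
      forall s t, arrays st 5 (pos false s t) = 0 -> {in L, forall b, b.1 != (s, t)}
    & {in L, forall b, turn b.1 \in ds} /\
      {in ds, forall d, connect G (turn d).1 (turn d).2 ->
        output_reach c st (turn d).1 (turn d).2}].

Lemma fresh_serving st : fresh st -> serving [::] [::] (run init st).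
Proof.
move=> [vn _ adj zero em0]; have [kn v3 snd sz con] := run_init vn adj zero em0.
have [_ aa _] := frame_run init st.
have zero' a i : a \notin [:: 0; 1; 2; 3] -> arrays (run init st) a i = 0.
  move=> ha; rewrite aa; last by move: ha; apply: contra; rewrite !inE; lia.
  by apply: zero; move: ha; rewrite inE negb_or => /andP[].
split=> //; last by move=> s t; rewrite zero'.
split=> //.
- move=> u v; rewrite scc_orient => uv; rewrite /output_reach connect_orient.
  by case: (c); apply: con; rewrite // scc_sym.
- by move=> u v; rewrite zero'.
Qed.

Lemma run_serve ds L st (d : 'I_n * 'I_n) :
    serving ds L st -> vars st 1 = d.1 -> vars st 2 = d.2 ->
  exists L', serving (rcons ds d) L'
    (run (tests [:: Equ (cell false 5 (src c) (dst c)) (Const 0);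
                    cell c 2 (src c) (dst c)]
           (Then (walk c) (Store 5 (offset false (src c) (dst c)) (Const 1)))) st).
Proof.
move=> [gr v3 done new [dem reach]] v1 v2.
have kn := growing_known gr.
have [vs vt] : vars st (src c) = (turn d).1 /\ vars st (dst c) = (turn d).2.
  by rewrite /turn; case: (c).
have turnK : turn (turn d) = d by rewrite /turn; case: (c); case: (d).
rewrite run_tests [all _ _]/= (eval_cell false 5 kn.1 vs vt) (known_cell c kn vs vt) -/G.
set s := (turn d).1 in vs *; set t := (turn d).2 in vt *.
have dE : turn d = (s, t) by rewrite /s /t; case: (turn d).
rewrite !bool_neq0 andbT; case: ifP => [/andP[]|no]; last first.
  exists L; split=> //; split=> [b /dem|d']; rewrite mem_rcons inE.
    by move=> ->; rewrite orbT.
  case/predU1P=> [->|]; last exact: reach.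
  (* The demand is skipped although [t] is reachable, so it was served before. *)
  rewrite dE /= => st_conn; apply: done => //.
  by move: no; rewrite st_conn andbT; case: eqP => // ->.
case: eqP => // /new notL _ st_conn; rewrite run_then.
have [L' [gr1 st_reach sub dem1]] := run_walk gr vs vt st_conn notL.
have [va aa _] := frame_run (walk c) st.
set st1 := run (walk c) st in gr1 st_reach sub va aa *.
have vs1 : vars st1 (src c) = s by rewrite va; case: (c) vs.
have vt1 : vars st1 (dst c) = t by rewrite va; case: (c) vt.
have -> : run (Store 5 (offset false (src c) (dst c)) (Const 1)) st1 =
    set_array 5 (pos false s t) 1 st1.
  by rewrite /= (eval_offset false (growing_known gr1).1 vs1 vt1).
set st2 := set_array _ _ _ _.
have reach_sub u v : output_reach c st u v -> output_reach c st2 u v.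
  exact: connect_output.
have arr u v : arrays st2 5 (pos false u v) =
    if (u == s) && (v == t) then 1 else arrays st 5 (pos false u v).
  by rewrite -(eq_pos false) -aa; case: (c).
exists L'; split.
- by apply: growing_frame (frame_run (Store 5 (Const (pos false s t)) (Const 1)) st1) gr1.
- by rewrite /= va; case: (c).
- move=> u v; rewrite arr; case: ifP => [/andP[/eqP-> /eqP->] //|_ uv].
  by move=> /(done u v uv)/reach_sub.
- move=> u v; rewrite arr; case: ifP => // ne uv b /dem1[/(new u v uv) //|->].
  by rewrite xpair_eqE eq_sym (eq_sym t) ne.
split=> [b /dem1[/dem|->]|d']; rewrite mem_rcons inE.
- by move=> ->; rewrite orbT.
- by rewrite -dE turnK eqxx.
by case/predU1P=> [->|/reach h /h /reach_sub //]; rewrite dE.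
Qed.

(** Initialisation is delayed to the first arrival, so the induction starts from either an untouched
    state or a [serving] one. *)
Lemma serve_demand_serves st ds0 L (ds : seq ('I_n * 'I_n)) :
    fresh st /\ ds0 = [::] \/ serving ds0 L st ->
  exists k st', [/\ serve (compile (serve_demand c)) st ds k st',
    k <= size ds * budget (serve_demand c) n &
    fresh st' /\ ds0 ++ ds = [::] \/ exists L', serving (ds0 ++ ds) L' st'].
Proof.
elim: ds st ds0 L => [|d ds IHds] st ds0 L ready.
  exists 0, st; split=> //; first exact: ServeNil.
  by rewrite cats0; case: ready; [left|right; exists L].
have v0 : vars st 0 = n by case: ready => [[[]]|[[[[]]]]].
have [k1 ex1 le1] := exec_compile (arrive d st) (serve_demand_wf c).
have [L' sv] : exists L', serving (rcons ds0 d) L' (run (serve_demand c) (arrive d st)).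
  rewrite /serve_demand run_then; set st1 := run (Test _ _) _.
  have [va _ _] : frame (Test (Equ (Var 3) (Const 0)) init) (arrive d st) st1.
    exact: frame_run.
  suff [L1 sv1] : exists L1, serving ds0 L1 st1.
    by apply: run_serve sv1 _ _; rewrite va.
  have arr_eq : st1 = if vars st 3 == 0 then run init (arrive d st) else arrive d st.
    by rewrite -(bool_neq0 (vars st 3 == 0)).
  rewrite arr_eq; case: ready => [[fr ->]|sv].
    have [_ -> _ _ _] := fr; exists [::]; apply: fresh_serving.
    by case: fr.
  have [gr v3 done new rest] := sv; rewrite v3; exists L; split=> //.
  (* The arrival of a demand has the frame of two assignments. *)
  by apply: growing_frame (frame_run (Then (Let 1 (Const d.1)) (Let 2 (Const d.2))) st) gr.
have [k2 [st2 [sv2 le2 ready2]]] := IHds _ _ L' (or_intror sv).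
exists (k1 + k2), st2; split.
- exact: ServeCons ex1 sv2.
- by rewrite mulSn leq_add // -v0.
by rewrite -cats1 -catA in ready2.
Qed.

End Main.

Lemma start_fresh n (E : rel 'I_n) : fresh E (start E).
Proof. by split=> // a i; rewrite /start /= /upd => /negPf->. Qed.

Lemma serve_demand_result c n (E : rel 'I_n) ds :
  exists k st, [/\ serve (compile (serve_demand c)) (start E) ds k st,
    k <= size ds * budget (serve_demand c) n,
    sound_output E st,
    reachability_preserver E (demands ds) (edges n st) &
    exists L : seq (entry n), [/\ growth_log (orient c E) L,
      {in L, forall b, turn c b.1 \in ds} & size (emitted st) <= size L + 2 * n]].
Proof.
have [k [st [sv le fin]]] :=
  @serve_demand_serves n E c (start E) [::] [::] ds (or_introl (conj (start_fresh E) erefl)).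
exists k, st; case: fin => [[[_ _ _ _ em] ds0]|[L [gr _ _ _ [dem reach]]]].
  rewrite /= in ds0; split=> //; first by move=> x y; rewrite em.
    by move=> s t; rewrite inE ds0.
  by exists [::]; rewrite em.
split=> //; first exact: growing_sound gr.
  move=> s t; rewrite inE => /reach; rewrite /output_reach !connect_orient.
  have -> : connect [rel u v | (u, v) \in edges n st] s t = connect (output_rel (emitted st)) s t.
    by apply: eq_connect => u v; rewrite /= inE.
  by rewrite /turn; case: (c).
by exists L; split=> //; [exact: growing_log gr|exact: growing_size gr].
Qed.

Lemma size_edges n (st : state) : #|edges n st| <= size (emitted st).
Proof.
pose f (d : 'I_n * 'I_n) := (val d.1, val d.2).
have f_inj : injective f by move=> [u v] [u' v'] [/val_inj-> /val_inj->].
rewrite cardE -(size_map f); apply: uniq_leq_size.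
  by rewrite map_inj_uniq ?enum_uniq.
by move=> x /mapP[d]; rewrite mem_enum inE => + ->.
Qed.

Lemma serve_demand_poly c : polynomial_time (compile (serve_demand c)).
Proof.
have [a [e le_budget]] := budget_poly (serve_demand c).
exists a, e.+1 => n E ds k st sv.
have [k' [st' [sv' le _ _ _]]] := serve_demand_result c E ds.
have [-> _] := serve_det sv sv'; apply: leq_trans le _.
rewrite expnS mulnCA; apply: leq_mul; first by lia.
apply: leq_trans (le_budget n) _; rewrite leq_mul2l; apply/orP; right.
by case: e {le_budget} => // e; rewrite leq_exp2r; lia.
Qed.

(** The log contributes at most 2 sqrt(n|S|p) + n edges and the trees 2n, whence the constant 3. *)
Lemma serve_demand_size c n (E : rel 'I_n) (S : {set 'I_n}) ds k st :
    {in ds, forall d, (turn c d).1 \in S} ->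
    serve (compile (serve_demand c)) (start E) ds k st ->
  (INR #|edges n st| <= 3 * (sqrt (INR (n * #|S| * #|demands ds|)) + INR n))%coqR.
Proof.
move=> inS sv; have [k' [st' [sv' _ _ _ [L [log dem szL]]]]] := serve_demand_result c E ds.
have [_ eq_st] := serve_det sv sv'; rewrite -{st' sv'}eq_st in szL.
have turnK : involutive (@turn n c) by rewrite /turn => -[u v]; case: (c).
pose D := [set turn c d | d in demands ds].
have inDS : {in L, forall a, a.1 \in D /\ a.1.1 \in S}.
  move=> a /dem aL; split; last by rewrite -(turnK a.1); apply: inS.
  by apply/imsetP; exists (turn c a.1); rewrite ?turnK // inE.
have szL2 := sqrt_bound (growth_log_size log inDS).
have {szL} : (INR #|edges n st| <= INR (size L) + 2 * INR n)%coqR.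
  rewrite -[2%coqR]/(INR 2) -mult_INR -plus_INR; apply/le_INR/leP.
  exact: leq_trans (size_edges n st) szL.
set q := n * (_ * _) in szL2.
have : (sqrt (INR q) <= sqrt (INR (n * #|S| * #|demands ds|)))%coqR.
  apply/sqrt_le_1_alt/le_INR/leP.
  by rewrite /q -mulnA leq_mul2l mulnC leq_mul2l leq_imset_card !orbT.
have := sqrt_pos (INR (n * #|S| * #|demands ds|)); have := pos_INR n.
by move=> n0 sq0 leD leE; lra.
Qed.

Theorem theorem3 :
  (exists A : cmd,
     [/\ online_preserver_algorithm A,
         polynomial_time A
       & exists K : R,
           forall (n : nat) (E : rel 'I_n) (S : {set 'I_n})
                  (ds : seq ('I_n * 'I_n)) (k : nat) (st : state),
             demands ds \subset setX S [set: 'I_n] ->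
             serve A (start E) ds k st ->
             (INR #|edges n st|
              <= K * (sqrt (INR (n * #|S| * #|demands ds|)) + INR n))%coqR])
  /\
  (exists A : cmd,
     [/\ online_preserver_algorithm A,
         polynomial_time A
       & exists K : R,
           forall (n : nat) (E : rel 'I_n) (S : {set 'I_n})
                  (ds : seq ('I_n * 'I_n)) (k : nat) (st : state),
             demands ds \subset setX [set: 'I_n] S ->
             serve A (start E) ds k st ->
             (INR #|edges n st|
              <= K * (sqrt (INR (n * #|S| * #|demands ds|)) + INR n))%coqR]).
Proof.
have online c : online_preserver_algorithm (compile (serve_demand c)).
  by move=> n E ds; have [k [st [sv _ snd pres _]]] := serve_demand_result c E ds; exists k, st.
split.
  exists (compile (serve_demand false)); split=> //; first exact: serve_demand_poly.
  exists 3%coqR => n E S ds k st /subsetP sub; apply: serve_demand_size => d d_ds.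
  by have := sub d; rewrite !inE d_ds => /(_ isT)/andP[].
exists (compile (serve_demand true)); split=> //; first exact: serve_demand_poly.
exists 3%coqR => n E S ds k st /subsetP sub; apply: serve_demand_size => d d_ds.
by have := sub d; rewrite !inE d_ds => /(_ isT)/andP[].
Qed.
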